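(* Let $R$ be a nonzero commutative ring with identity and let $G$ be a torsion abelian group. The following conditions are equivalent. (1) $\mathfrak{J}(RG)=\Phi(N)$ for some subgroup $N\neq 1$ of $G$. (2) $\mathfrak{J}(R)=0$ and $\operatorname{char} R=p$ for some prime $p\in\operatorname{supp} G$. Moreover, if these conditions are satisfied (with $p=\operatorname{char} R$), then $\mathfrak{J}(RG)=\Phi(G_p)$.
   Context: All groups are abelian and written multiplicatively. $RG$ is the group ring of $G$ over $R$. For a subgroup $N$ of $G$, $I(R,N)$ is the augmentation ideal of $RN$, i.e. the kernel of the $R$-algebra homomorphism $RN\to R$ sending every element of $N$ to $1$, and $\Phi(N)=I(R,N)RG$ is the ideal of $RG$ generated by $I(R,N)$. $\mathfrak{J}(A)$ denotes the Jacobson radical of a ring $A$ and $\operatorname{char} A$ its characteristic. For a prime $p$, $G_p$ is the set of elements of $G$ whose order is a power of $p$, and $\operatorname{supp} G$ is the set of primes $p$ with $G_p\neq 1$. *)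

(* Defs.v *)
(* Group rings of possibly infinite groups are built on the
   finitely supported functions {malg R[G]} of the multinomials library, whose
   own product is only available for monoids without nontrivial units. *)
From HB Require Import structures.
From mathcomp Require Import all_boot all_order all_algebra finmap.
From mathcomp Require Import boolp classical_sets.
From mathcomp.multinomials Require Import monalg.

Set Implicit Arguments.
Unset Strict Implicit.
Unset Printing Implicit Defensive.

Import GRing.Theory.

Local Open Scope ring_scope.

Definition groupRing (R : nzRingType) (G : groupType) : Type := {malg R[G]}.

HB.instance Definition _ (R : nzRingType) (G : groupType) :=
  GRing.Lmodule.copy (groupRing R G) {malg R[G]}.

Section GroupRing.
Local Open Scope fset_scope.
Context (R : nzRingType) (G : groupType).
Implicit Types (x y z : groupRing R G).

Definition gr_one : groupRing R G := << 1 *g 1%g >>.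

Definition gr_mul x y : groupRing R G :=
  \sum_(g <- msupp x) \sum_(h <- msupp y) << x@_g * y@_h *g (g * h)%g >>.

Lemma gr_mulw (d1 d2 : {fset G}) x y :
  msupp x `<=` d1 -> msupp y `<=` d2 ->
  gr_mul x y = \sum_(g <- d1) \sum_(h <- d2) << x@_g * y@_h *g (g * h)%g >>.
Proof.
move=> le_d1 le_d2; rewrite /gr_mul (big_fset_incl _ le_d1) /=.
  apply/eq_bigr=> k1 _; apply/big_fset_incl => // k _ /mcoeff_outdom ->.
  by rewrite mulr0 monalgU0.
move=> k _ /mcoeff_outdom g1k.
by rewrite big1 => // k' _; rewrite g1k mul0r monalgU0.
Qed.

Lemma gr_mul0l : left_zero (0 : groupRing R G) gr_mul.
Proof. by move=> x; rewrite /gr_mul msupp0 big_seq_fset0. Qed.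

Lemma gr_mul0r : right_zero (0 : groupRing R G) gr_mul.
Proof. by move=> x; rewrite /gr_mul exchange_big msupp0 big_seq_fset0. Qed.

Lemma gr_mulDl : left_distributive gr_mul +%R.
Proof.
move=> x y z; rewrite (gr_mulw (msuppD_le x y) (fsubset_refl (msupp z))).
rewrite (gr_mulw (fsubsetUl (msupp x) (msupp y)) (fsubset_refl (msupp z))).
rewrite (gr_mulw (fsubsetUr (msupp x) (msupp y)) (fsubset_refl (msupp z))).
rewrite -big_split /=; apply/eq_bigr=> g _.
rewrite -big_split /=; apply/eq_bigr=> h _.
by rewrite mcoeffD mulrDl monalgUD.
Qed.

Lemma gr_mulDr : right_distributive gr_mul +%R.
Proof.
move=> z x y; rewrite (gr_mulw (fsubset_refl (msupp z)) (msuppD_le x y)).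
rewrite (gr_mulw (fsubset_refl (msupp z)) (fsubsetUl (msupp x) (msupp y))).
rewrite (gr_mulw (fsubset_refl (msupp z)) (fsubsetUr (msupp x) (msupp y))).
rewrite -big_split /=; apply/eq_bigr=> g _.
rewrite -big_split /=; apply/eq_bigr=> h _.
by rewrite mcoeffD mulrDr monalgUD.
Qed.

Lemma gr_mulUU (a b : R) (g h : G) :
  gr_mul << a *g g >> << b *g h >> = << a * b *g (g * h)%g >>.
Proof.
by rewrite (gr_mulw (d1 := [fset g]) (d2 := [fset h])) ?msuppU_le //
  !big_seq_fset1 !mcoeffUU.
Qed.

Lemma gr_mul_suml (I : Type) (s : seq I) (F : I -> groupRing R G) y :
  gr_mul (\sum_(i <- s) F i) y = \sum_(i <- s) gr_mul (F i) y.
Proof. exact: (big_morph (gr_mul^~ y) (fun _ _ => gr_mulDl _ _ _) (gr_mul0l y)). Qed.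

Lemma gr_mul_sumr (I : Type) (s : seq I) (F : I -> groupRing R G) y :
  gr_mul y (\sum_(i <- s) F i) = \sum_(i <- s) gr_mul y (F i).
Proof. exact: (big_morph (gr_mul y) (fun _ _ => gr_mulDr _ _ _) (gr_mul0r y)). Qed.

Lemma grE x : x = \sum_(g <- msupp x) (<< x@_g *g g >> : groupRing R G).
Proof. exact: monalgE. Qed.

Lemma gr_mul1l : left_id gr_one gr_mul.
Proof.
move=> x; rewrite [x in LHS]grE gr_mul_sumr [RHS]grE.
by apply: eq_bigr => g _; rewrite gr_mulUU mul1r mul1g.
Qed.

Lemma gr_mul1r : right_id gr_one gr_mul.
Proof.
move=> x; rewrite [x in LHS]grE gr_mul_suml [RHS]grE.
by apply: eq_bigr => g _; rewrite gr_mulUU mulr1 mulg1.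
Qed.

Lemma gr_mulA : associative gr_mul.
Proof.
move=> x y z; rewrite (grE x) !gr_mul_suml; apply: eq_bigr => g _.
rewrite (grE y) gr_mul_suml !gr_mul_sumr gr_mul_suml; apply: eq_bigr => h _.
rewrite (grE z) !gr_mul_sumr; apply: eq_bigr => k _.
by rewrite !gr_mulUU mulrA mulgA.
Qed.

Lemma gr_one_neq0 : gr_one != 0.
Proof. by rewrite /gr_one monalgU_eq0 oner_eq0. Qed.

HB.instance Definition _ := GRing.Zmodule_isNzRing.Build (groupRing R G)
  gr_mulA gr_mul1l gr_mul1r gr_mulDl gr_mulDr gr_one_neq0.

Lemma gr_scaleAl (a : R) x y : a *: (x * y) = (a *: x) * y.
Proof.
have sU (c : R) (g : G) :
    a *: (<< c *g g >> : groupRing R G) = << a * c *g g >>.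
  by apply/malgP => k; rewrite mcoeffZ !mcoeffU mulrnAr.
change (a *: gr_mul x y = gr_mul (a *: x) y).
rewrite (grE x) gr_mul_suml !scaler_sumr gr_mul_suml; apply: eq_bigr => g _.
rewrite (grE y) !gr_mul_sumr scaler_sumr; apply: eq_bigr => h _.
by rewrite sU !gr_mulUU sU mulrA.
Qed.

HB.instance Definition _ :=
  GRing.Lmodule_isLalgebra.Build R (groupRing R G) gr_scaleAl.

Definition augmentation x : R := \sum_(g <- msupp x) x@_g.

Lemma augmentationw (d : {fset G}) x :
  msupp x `<=` d -> augmentation x = \sum_(g <- d) x@_g.
Proof.
move=> le_d; rewrite /augmentation (big_fset_incl _ le_d) //=.
by move=> g _ /mcoeff_outdom.
Qed.

Lemma augmentationU (a : R) (g : G) : augmentation << a *g g >> = a.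
Proof.
by rewrite (augmentationw (d := [fset g])) ?msuppU_le // big_seq_fset1 mcoeffUU.
Qed.

Lemma augmentation_is_zmod_morphism : zmod_morphism augmentation.
Proof.
move=> x y; rewrite (augmentationw (msuppB_le x y)).
rewrite (augmentationw (fsubsetUl (msupp x) (msupp y))).
rewrite (augmentationw (fsubsetUr (msupp x) (msupp y))).
by rewrite -sumrB; apply: eq_bigr => g _; rewrite mcoeffB.
Qed.

HB.instance Definition _ := GRing.isZmodMorphism.Build (groupRing R G) R
  augmentation augmentation_is_zmod_morphism.

Lemma augmentation_is_monoid_morphism : monoid_morphism augmentation.
Proof.
split; first exact: augmentationU.
move=> x y; rewrite {1}/GRing.mul /= /gr_mul raddf_sum /= mulr_suml.
apply: eq_bigr => g _; rewrite raddf_sum mulr_sumr.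
by apply: eq_bigr => h _; rewrite /= augmentationU.
Qed.

HB.instance Definition _ := GRing.isMonoidMorphism.Build (groupRing R G) R
  augmentation augmentation_is_monoid_morphism.

Lemma augmentation_is_scalable : scalable_for *%R augmentation.
Proof.
move=> a x; rewrite (augmentationw (msuppZ_le a x)) mulr_sumr.
by apply: eq_bigr => g _; rewrite mcoeffZ.
Qed.

HB.instance Definition _ := GRing.isScalable.Build R (groupRing R G) R *%R
  augmentation augmentation_is_scalable.

End GroupRing.

Lemma gr_mulC (R : comNzRingType) (G : groupType) :
  (forall g h : G, commute g h) -> commutative (@GRing.mul (groupRing R G)).
Proof.
move=> mulgC x y; change (gr_mul x y = gr_mul y x).
rewrite /gr_mul exchange_big; apply: eq_bigr => g _; apply: eq_bigr => h _.
by rewrite mulrC mulgC.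
Qed.

Local Open Scope classical_set_scope.

(* For a commutative ring, the left ideals below are the ideals; the definition
   is one-sided because commutativity of R G is a consequence of that of G
   (gr_mulC) rather than part of the type of the ring. *)
Section JacobsonRadical.
Context (A : nzRingType).

Definition left_ideal (I : set A) : Prop :=
  [/\ I 0, (forall x y, I x -> I y -> I (x + y))
    & forall a x, I x -> I (a * x)].

Definition maximal_left_ideal (M : set A) : Prop :=
  [/\ left_ideal M, M <> setT
    & forall I : set A, left_ideal I -> M `<=` I -> I = M \/ I = setT].

Definition jacobson_radical : set A :=
  \bigcap_(M in [set M | maximal_left_ideal M]) M.

End JacobsonRadical.

Arguments jacobson_radical A : clear implicits.

Section Groups.
Context (G : groupType).
Implicit Types (N : set G) (g : G) (n p : nat).

Definition subgroup N : Prop :=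
  [/\ N 1%g, (forall g h, N g -> N h -> N (g * h)%g)
    & forall g, N g -> N g^-1%g].

(* The order of an element, as a relation since it may be infinite. *)
Definition has_order g n : Prop :=
  [/\ (0 < n)%N, (g ^+ n = 1)%g
    & forall m : nat, (0 < m)%N -> (g ^+ m = 1)%g -> (n <= m)%N].

Definition torsion_group : Prop := forall g, exists n, has_order g n.

Definition p_component p : set G := [set g | exists k : nat, has_order g (p ^ k)].

Definition supp_group : set nat :=
  [set p | prime p /\ p_component p <> [set 1%g]].

End Groups.

Arguments p_component G p : clear implicits.
Arguments supp_group G : clear implicits.

Section RelativeAugmentation.
Context (R : nzRingType) (G : groupType).

(* R N is identified with the elements of R G supported in N. *)
Definition augmentation_ideal (N : set G) : set (groupRing R G) :=
  [set x | (forall g, g \in msupp x -> N g) /\ augmentation x = 0].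

(* The elements of I(R,N) R G, i.e. finite sums of products. *)
Definition Phi (N : set G) : set (groupRing R G) :=
  [set z | exists2 s : seq (groupRing R G * groupRing R G),
     (forall u, u \in s -> augmentation_ideal N u.1)
     & z = \sum_(u <- s) u.1 * u.2].

End RelativeAugmentation.

Arguments augmentation_ideal R [G] N.
Arguments Phi R [G] N.

(* Main.v *)
Require Import Defs.
From mathcomp Require Import all_boot all_order all_algebra.
From mathcomp Require Import boolp classical_sets.
From HB Require Import structures.
From mathcomp Require cyclic.
From mathcomp Require Import finmap.
From mathcomp.multinomials Require Import monalg.

(** Since [G] is torsion and abelian, [R G] is commutative and integral over
    [R]; both implications rest on this.

    Suppose first that the Jacobson radical of [R G] is [Phi N] with [N] not
    trivial. By integrality a maximal ideal of [R G] contracts to a maximal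
    ideal of [R], so the radical of [R] is contained in that of [R G]
    ([scalar_jacobson]); all elements of [Phi N] have augmentation [0], hence
    the radical of [R] vanishes. Next, [N] contains an element [g] of prime
    order [p], and [1 - g] lies in the radical of [R G]. So does
    [s = \sum_(i < p) (1 - g ^ i)], which satisfies [s * s = p * s]: it is [p]
    times the complement of the averaging idempotent that would exist if [p]
    were invertible. Comparing coefficients in the equation that inverts
    [1 - a * s] shows that [1 - a * p] is invertible in [R] for every [a]
    ([order_jacobson]), so [p] is in the radical of [R] and [p = 0] in [R].

    Conversely, let [R] have characteristic [p] and zero radical. For [g] in
    [G_p] the element [1 - g] is nilpotent, whence [Phi G_p] is contained in the
    radical. For the other inclusion let [x] be in the radical, and choose
    [q = p ^ k] such that [g |-> g ^ q] is the projection to the [p']-part on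
    the support of [x] ([p_prime_projection_exponent]). Replacing each [g] by
    [g ^ q] changes [x] by an element of [Phi G_p] and gives [y] in the radical
    with [h ^ q = h] on its support. Then Frobenius acts on coefficients only:
    [y ^ (q ^ i)] has the coefficients [y_h ^ (q ^ i)]. Modulo a maximal ideal
    [m] of [R] the element [y] is algebraic over a field and in the radical, so
    some power of [y] has all its coefficients in [m]
    ([jacobson_exp_coef_in]), and therefore [y] itself has. As [m] is
    arbitrary, all coefficients of [y] are in the radical of [R], so [y = 0]. *)

Set Implicit Arguments.
Unset Strict Implicit.
Unset Printing Implicit Defensive.

Import GRing.Theory.

Local Open Scope ring_scope.
Local Open Scope classical_set_scope.

(** * Maximal left ideals and the Jacobson radical *)

Section MaximalLeftIdeals.
Variable A : nzRingType.
Implicit Types (I M : set A) (x y : A).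

Lemma left_idealB I x y : left_ideal I -> I x -> I y -> I (x - y).
Proof. by case=> _ ID IM Ix Iy; rewrite -mulN1r; apply/ID/IM. Qed.

Lemma left_ideal_sum I (T : eqType) (s : seq T) (F : T -> A) :
  left_ideal I -> (forall i, i \in s -> I (F i)) -> I (\sum_(i <- s) F i).
Proof.
by case=> I0 ID _ IF; rewrite big_seq; elim/big_ind: _ => // x y; apply: ID.
Qed.

Lemma maximal_left_ideal_proper M : maximal_left_ideal M -> ~ M 1.
Proof.
case=> [[_ _ MM] MnT _] M1; apply: MnT; apply/seteqP; split=> // x _.
by rewrite -[x]mulr1; apply: MM.
Qed.

Lemma maximal_left_ideal_inverse M x :
  maximal_left_ideal M -> ~ M x -> exists a, M (1 - a * x).
Proof.
case=> [[M0 MD MM] MnT Mmax] Mnx.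
pose I := [set y | exists a, M (y - a * x)].
have idI : left_ideal I.
  split=> [|y z [a My] [b Mz]|b y [a My]].
  - by exists 0; rewrite mul0r subr0.
  - by exists (a + b); rewrite mulrDl opprD addrACA; apply: MD.
  - by exists (b * a); rewrite -mulrA -mulrBr; apply: MM.
have MI : M `<=` I by move=> y My; exists 0; rewrite mul0r subr0.
case: (Mmax I idI MI) => [IM|IT].
  by case: Mnx; rewrite -IM; exists 1; rewrite mul1r subrr.
have I1 : I 1 by rewrite IT.
exact: I1.
Qed.

(** Krull's theorem. Zorn's lemma is stated for chains of sets that may be
    empty, so the ordered family contains the empty set besides the proper left
    ideals above [I]: this is why [0] is not required to be a member and why the
    condition of lying above [I] is only imposed on inhabited sets. *)
Lemma maximal_left_ideal_above I :
  left_ideal I -> ~ I 1 -> exists2 M, maximal_left_ideal M & I `<=` M.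
Proof.
move=> idI In1; have [I0 ID IM] := idI.
pose P := [set X : set A | [/\ forall x y, X x -> X y -> X (x + y),
  forall a x, X x -> X (a * x), ~ X 1 & forall x y, X x -> I y -> X y]].
have [|M [[MD MM Mn1 MI] Mmax]] := @Zorn_bigcup A P.
  move=> F FP Ftot; split.
  - move=> x y [X FX Xx] [Y FY Yy].
    have [XY|YX] := Ftot X Y FX FY.
      exists Y => //; have [YD _ _ _] := FP _ FY.
      by apply: YD => //; apply: XY.
    exists X => //; have [XD _ _ _] := FP _ FX.
    by apply: XD => //; apply: YX.
  - move=> a x [X FX Xx]; exists X => //; have [_ XM _ _] := FP _ FX.
    exact: XM.
  - by move=> [X FX X1]; have [_ _ Xn1 _] := FP _ FX; apply: Xn1.
  - move=> x y [X FX Xx] Iy; exists X => //.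
    by have [_ _ _ XI] := FP _ FX; apply: XI Xx Iy.
have [x Mx] : exists x, M x.
  apply: contrapT => Mn; apply: (Mmax I); last by split.
  split=> [y My | IM0]; first by case: Mn; exists y.
  by apply: Mn; exists 0; apply: IM0.
have IsM : I `<=` M by move=> y; apply: MI Mx.
exists M => //; split=> [|MT|J [J0 JD JM] MJ].
- by split=> //; apply: IsM.
- by apply: Mn1; rewrite MT.
have [J1|Jn1] := pselect (J 1).
  by right; apply/seteqP; split=> // y _; rewrite -[y]mulr1; apply: JM.
left; apply/seteqP; split=> //; apply: contrapT => JnM.
apply: (Mmax J); first by split.
by split=> // y z _ Iz; apply/MJ/IsM.
Qed.

Lemma jacobson_left_ideal : left_ideal (jacobson_radical A).
Proof.
split=> [M [[M0 _ _] _ _] //|x y Jx Jy M maxM|a x Jx M maxM].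
  by have [[_ MD _] _ _] := maxM; apply: MD; [apply: Jx|apply: Jy].
by have [[_ _ MM] _ _] := maxM; apply: MM (Jx M maxM).
Qed.

(** This is the direction that needs Krull's theorem: a maximal left ideal above
    [A * (1 - a * x)] would contain both [a * x] and [1 - a * x]. *)
Lemma jacobson_left_inverse x a :
  jacobson_radical A x -> exists b, b * (1 - a * x) = 1.
Proof.
move=> Jx; pose I := [set y | exists b, b * (1 - a * x) = y].
have idI : left_ideal I.
  split=> [|_ _ [b <-] [c <-]|c _ [b <-]].
  - by exists 0; rewrite mul0r.
  - by exists (b + c); rewrite mulrDl.
  - by exists (c * b); rewrite mulrA.
apply: contrapT => In1; have [M maxM IM] := maximal_left_ideal_above idI In1.
have [[_ MD MM] _ _] := maxM; apply: (maximal_left_ideal_proper maxM).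
rewrite -(subrK (a * x) 1); apply: MD; last exact: MM (Jx M maxM).
by apply: IM; exists 1; rewrite mul1r.
Qed.

Lemma left_inverse_jacobson x :
  (forall a, exists b, b * (1 - a * x) = 1) -> jacobson_radical A x.
Proof.
move=> invx M maxM; apply: contrapT => Mnx.
have [a Ma] := maximal_left_ideal_inverse maxM Mnx; have [b ba1] := invx a.
apply: (maximal_left_ideal_proper maxM); rewrite -ba1.
by have [[_ _ MM] _ _] := maxM; apply: MM.
Qed.

Hypothesis mulC : commutative (@GRing.mul A).

Lemma maximal_left_ideal_exp M x n :
  maximal_left_ideal M -> M (x ^+ n) -> M x.
Proof.
move=> maxM; have [[_ MD MM] _ _] := maxM; elim: n => [|n IHn] Mxn.
  by case: (maximal_left_ideal_proper maxM).
apply: contrapT => Mnx; have [a Ma] := maximal_left_ideal_inverse maxM Mnx.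
apply: Mnx; apply: IHn.
have -> : x ^+ n = x ^+ n * (1 - a * x) + a * x ^+ n.+1.
  by rewrite mulrBr mulr1 exprS mulrA (mulC (x ^+ n)) subrK.
by apply: MD; apply: MM.
Qed.

Lemma nilpotent_jacobson x n : x ^+ n = 0 -> jacobson_radical A x.
Proof.
move=> xn0 M maxM; apply: (@maximal_left_ideal_exp M x n maxM).
by rewrite xn0; case: maxM => [[]].
Qed.

End MaximalLeftIdeals.

(** * Orders of elements and primary components *)

Section TorsionGroups.
Variable G : groupType.
Implicit Types (g h : G) (n p : nat).

Lemma has_order_dvdn g n m : has_order g n -> (g ^+ m = 1)%g -> (n %| m)%N.
Proof.
move=> [n_gt0 gn1 gmin] gm1; rewrite /dvdn eqn0Ngt; apply/negP => r_gt0.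
have /gmin : (g ^+ (m %% n) = 1)%g.
  by move: gm1; rewrite {1}(divn_eq m n) mulnC expgnDr expgnA gn1 expg1n mul1g.
by move=> /(_ r_gt0); rewrite leqNgt ltn_mod n_gt0.
Qed.

Lemma has_order_expg g n d :
  has_order g n -> (d %| n)%N -> has_order (g ^+ (n %/ d))%g d.
Proof.
move=> og dvd_dn; have [n_gt0 gn1 _] := og.
have d_gt0 := dvdn_gt0 n_gt0 dvd_dn.
split=> // [|m m_gt0 gm1]; first by rewrite -expgnA divnK.
apply: dvdn_leq => //; move: gm1; rewrite -expgnA => /(has_order_dvdn og).
by rewrite -{1}(divnK dvd_dn) dvdn_pmul2l // divn_gt0 // dvdn_leq.
Qed.

Hypothesis torsionG : torsion_group G.

(** Some power of [p] killing [g] suffices, instead of being its exact order;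
    in this form membership is stable under products. *)
Lemma p_componentP p g : prime p ->
  p_component G p g <-> exists k : nat, (g ^+ (p ^ k) = 1)%g.
Proof.
move=> p_pr; split=> [[k [_ gk1 _]]|[k gk1]]; first by exists k.
have [n og] := torsionG g.
have /(dvdn_pfactor _ _ p_pr) [j _ nE] := has_order_dvdn og gk1.
by exists j; rewrite -nE.
Qed.

Lemma subgroup_p_component p : (forall g h, commute g h) -> prime p ->
  subgroup (p_component G p).
Proof.
move=> mulgC p_pr; split=> [|g h|g].
- by apply/(p_componentP _ p_pr); exists 0%N; rewrite expg1n.
- move=> /(p_componentP _ p_pr) [k gk1] /(p_componentP _ p_pr) [l hl1].
  apply/(p_componentP _ p_pr); exists (k + l)%N; rewrite expnD expgMn //.
  by rewrite expgnA gk1 expg1n mul1g mulnC expgnA hl1 expg1n.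
- move=> /(p_componentP _ p_pr) [k gk1].
  by apply/(p_componentP _ p_pr); exists k; rewrite expVgn gk1 invg1.
Qed.

Lemma torsion_exponent (s : seq G) :
  exists2 n : nat, (0 < n)%N & forall g, g \in s -> (g ^+ n = 1)%g.
Proof.
elim: s => [|g s [n n_gt0 sn1]]; first by exists 1%N.
have [m [m_gt0 gm1 _]] := torsionG g.
exists (m * n)%N => [|h]; first by rewrite muln_gt0 m_gt0.
rewrite inE => /orP[/eqP ->|/sn1 hn1]; first by rewrite expgnA gm1 expg1n.
by rewrite mulnC expgnA hn1 expg1n.
Qed.

End TorsionGroups.

(** Take [k] to be a large multiple of the totient of the [p']-part of [n]. The
    exponent [p ^ k] is at once divisible by the [p]-part of [n] and, by
    Euler's theorem, congruent to [1] modulo its [p']-part. Raising to the power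
    [p ^ k] is then the projection of a group of exponent [n] onto its
    [p']-component. *)
Lemma p_prime_projection_exponent p n : prime p -> (0 < n)%N ->
  exists2 k : nat, (0 < k)%N & (n %| p ^ k * (p ^ k).-1)%N.
Proof.
move=> p_pr n_gt0; set m := (n`_(p^'))%N.
have m_gt0 : (0 < m)%N by apply: part_gt0.
exists (totient m * (logn p n).+1)%N; first by rewrite muln_gt0 totient_gt0 m_gt0.
have co_pm : coprime p m.
  apply: (@pnat_coprime p); [exact: pnat_id|exact: part_pnat].
rewrite -[n in (n %| _)%N](partnC p n_gt0) Gauss_dvd; last first.
  by apply: (@pnat_coprime p); apply: part_pnat.
apply/andP; split.
  rewrite dvdn_mulr // p_part dvdn_exp2l //.
  by apply: leq_trans (leqnSn _) (leq_pmull _ _); rewrite totient_gt0.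
rewrite dvdn_mull // -subn1 -eqn_mod_dvd ?expn_gt0 ?prime_gt0 //.
by rewrite expnM -modnXm (cyclic.Euler_exp_totient co_pm) modnXm exp1n.
Qed.

(** * Group rings of abelian groups *)

Lemma expr_sum_pchar (A : comNzRingType) p k (T : Type) (s : seq T) (F : T -> A) :
  p \in [pchar A] ->
  (\sum_(i <- s) F i) ^+ (p ^ k) = \sum_(i <- s) F i ^+ (p ^ k).
Proof.
move=> pA; have p_pr := pcharf_prime pA; apply: (big_morph (fun x => x ^+ _)).
  by move=> x y; rewrite exprDn_pchar // pnatX (pnatE _ p_pr) pA.
by rewrite expr0n expn_eq0 eqn0Ngt prime_gt0.
Qed.

(** Commutativity of [G] is a hypothesis and not a structure, so the commutative
    algebra structure on the group ring is not inferred. It is packed here, on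
    the same carrier and with the same operations, in order to apply the theory
    of integral elements and of the Frobenius map. *)
Definition comm_groupRing (R : comNzRingType) (G : groupType)
    (mulgC : forall g h : G, commute g h) : comNzRingType :=
  HB.pack (groupRing R G)
    (GRing.PzRing_hasCommutativeMul.Build (groupRing R G) (gr_mulC mulgC)).

Definition comm_groupAlg (R : comNzRingType) (G : groupType)
    (mulgC : forall g h : G, commute g h) : comAlgType R :=
  HB.pack (groupRing R G) (comm_groupRing R mulgC)
    (GRing.Lalgebra_isComAlgebra.Build R (comm_groupRing R mulgC)).

Section GroupRings.
Variables (R : comNzRingType) (G : groupType).
Implicit Types (x y : groupRing R G) (g h : G) (N : set G) (m : set R).

Local Notation RG := (groupRing R G).
Local Notation "a *g: g" := (<< a *g g >> : groupRing R G)
  (at level 40, g at next level).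

Lemma gr_mulU a b g h : (a *g: g) * (b *g: h) = (a * b) *g: (g * h)%g.
Proof. exact: gr_mulUU. Qed.

Lemma gr_expU a g n : (a *g: g) ^+ n = (a ^+ n) *g: (g ^+ n)%g.
Proof. by elim: n => // n IHn; rewrite !exprS IHn gr_mulU expgS. Qed.

Lemma gr_scaleU a b g : a *: (b *g: g) = (a * b) *g: g.
Proof. by apply/malgP => h; rewrite mcoeffZ !mcoeffU mulrnAr. Qed.

Lemma gr_mcoeff_sum (T : Type) (s : seq T) (F : T -> RG) g :
  (\sum_(i <- s) F i)@_g = \sum_(i <- s) (F i)@_g.
Proof. by elim/big_rec2: _ => [|i a y _ <-]; rewrite ?mcoeff0 ?mcoeffD. Qed.

Lemma gr_algE (a : R) : a%:A = a *g: 1%g.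
Proof. by rewrite (gr_scaleU a 1 1%g) mulr1. Qed.

(** For an ideal [m] of [R] this is the extended ideal [m R G]; it stands in for
    the kernel of the reduction to the group ring over [R / m]. *)
Definition coef_in m : set RG := [set x | forall g, m x@_g].

Lemma coef_in_left_ideal m : left_ideal m -> left_ideal (coef_in m).
Proof.
move=> idm; have [m0 mD mM] := idm; split=> [g|x y mx my g|a x mx g].
- by rewrite mcoeff0.
- by rewrite mcoeffD; apply: mD.
change (m (gr_mul a x)@_g); rewrite /gr_mul gr_mcoeff_sum.
apply: left_ideal_sum => // h _; rewrite gr_mcoeff_sum.
apply: left_ideal_sum => // k _; rewrite mcoeffU.
by case: eqP => _; [apply: mM|].
Qed.

Lemma Phi_augmentation N z : Phi R N z -> augmentation z = 0.
Proof.
move=> [s sN ->]; rewrite raddf_sum /= big1_seq // => u /sN [_ u0].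
by rewrite rmorphM /= u0 mul0r.
Qed.

Lemma augmentation_ideal_sub1 N g :
  subgroup N -> N g -> augmentation_ideal R N (1 - 1 *g: g).
Proof.
move=> [N1 _ _] Ng; split=> [h|].
  rewrite -mcoeff_neq0 mcoeffB !mcoeffU.
  by case: (1%g =P h) => [<- //|_]; case: (g =P h) => [<- //|_]; rewrite subrr eqxx.
by rewrite raddfB /= rmorph1 augmentationU subrr.
Qed.

Lemma Phi_sub1 N g : subgroup N -> N g -> Phi R N (1 - 1 *g: g).
Proof.
move=> subN Ng; exists [:: (1 - 1 *g: g, 1)]; last by rewrite big_seq1 mulr1.
by move=> u; rewrite inE => /eqP -> /=; apply: augmentation_ideal_sub1.
Qed.

Hypothesis mulgC : forall g h : G, commute g h.
Let grC : commutative (@GRing.mul RG) := gr_mulC mulgC.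

Let gr_scaleAr a x y : a *: (x * y) = x * (a *: y).
Proof. exact: (@scalerAr R (comm_groupAlg R mulgC)). Qed.

Let gr_algr a x : x * a%:A = a *: x.
Proof. by rewrite -gr_scaleAr mulr1. Qed.

Let gr_exprZ a x n : (a *: x) ^+ n = a ^+ n *: x ^+ n.
Proof. exact: (@exprZn R (comm_groupAlg R mulgC)). Qed.

(** An element [u] of the augmentation ideal is a combination of the [g - 1],
    because subtracting its augmentation from it changes nothing. *)
Lemma Phi_jacobson N :
  (forall g, N g -> jacobson_radical RG (1 - 1 *g: g)) ->
  Phi R N `<=` jacobson_radical RG.
Proof.
move=> NJ _ [s sN ->]; have idJ := @jacobson_left_ideal RG.
have [_ _ JM] := idJ; apply: left_ideal_sum => // u /sN [u1N u1_0].
rewrite grC; apply: (JM).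
have -> : u.1 = \sum_(g <- msupp u.1) (- u.1@_g)%:A * (1 - 1 *g: g).
  under eq_bigr => g _ do
    rewrite mulr_algl scalerBr !scaleNr opprK (gr_scaleU _ 1 g) mulr1 addrC.
  rewrite sumrB -grE -scaler_suml; move: u1_0; rewrite /augmentation => ->.
  by rewrite scale0r subr0.
by apply: left_ideal_sum => // g /u1N /NJ; apply: JM.
Qed.

Section PrimeCharacteristic.
Variable p : nat.
Hypothesis pR : p \in [pchar R].
Let p_pr : prime p := pcharf_prime pR.

Lemma pchar_groupRing : p \in [pchar comm_groupAlg R mulgC].
Proof. exact: (rmorph_pchar (GRing.in_alg (comm_groupAlg R mulgC)) pR). Qed.

Lemma gr_exp_pchar x k :
  x ^+ (p ^ k) = \sum_(g <- msupp x) (x@_g ^+ (p ^ k)) *g: (g ^+ (p ^ k))%g.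
Proof.
rewrite {1}(grE x).
rewrite (@expr_sum_pchar (comm_groupAlg R mulgC) p k _ _ _ pchar_groupRing).
by apply: eq_bigr => g _; apply: gr_expU.
Qed.

(** With [q = p ^ k] the order of [g], [(1 - g) ^ q = 1 - g ^ q = 0]. *)
Lemma p_element_jacobson g : p_component G p g ->
  jacobson_radical RG (1 - 1 *g: g).
Proof.
move=> [k [_ gk1 _]]; apply: (nilpotent_jacobson grC (n := (p ^ k)%N)).
have kP : [pchar comm_groupAlg R mulgC].-nat (p ^ k)%N.
  by rewrite pnatX (pnatE _ p_pr) pchar_groupRing.
(* Adding [g] back avoids the sign in [(1 - g) ^ q], which depends on [p]. *)
have := @exprDn_pchar (comm_groupAlg R mulgC) (1 - 1 *g: g) (1 *g: g) _ kP.
rewrite subrK expr1n gr_expU gk1 expr1n => E.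
by apply: (addIr (1 : RG)); rewrite add0r; symmetry.
Qed.

(** Distinct support elements keep distinct images under a power map that fixes
    them, so no two terms of the Frobenius expansion are collected. *)
Lemma mcoeff_exp_fixed y k i h :
  (forall g, g \in msupp y -> (g ^+ (p ^ k))%g = g) ->
  (y ^+ (p ^ (k * i)))@_h = y@_h ^+ (p ^ (k * i)).
Proof.
move=> yfix; have yfixi g : g \in msupp y -> (g ^+ (p ^ (k * i)))%g = g.
  move=> yg; rewrite expnM; elim: i => [|i IHi]; first by rewrite expn0 expg1.
  by rewrite expnSr expgnA IHi yfix.
rewrite gr_exp_pchar gr_mcoeff_sum.
have [yh|ynh] := boolP (h \in msupp y).
  rewrite (big_fsetD1 h) //= yfixi // mcoeffUU big1_fset ?addr0 // => g.
  rewrite in_fsetD1 => /andP[gnh yg] _.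
  by rewrite yfixi // mcoeffU (negPf gnh).
rewrite (mcoeff_outdom ynh) expr0n expn_eq0 eqn0Ngt prime_gt0 //=.
rewrite big1_fset // => g yg _.
by rewrite yfixi // mcoeffU; case: eqP => // gh; rewrite -gh yg in ynh.
Qed.

End PrimeCharacteristic.

Section Torsion.
Hypothesis torsionG : torsion_group G.

(** Each [g] is a root of ['X^n - 1] for [n] its order, and sums and products of
    integral elements are integral. *)
Lemma groupRing_integral x : integralOver (GRing.in_alg RG) x.
Proof.
pose A := comm_groupAlg R mulgC.
change (@integralOver R A (GRing.in_alg A) x).
rewrite (grE x).
elim/big_ind: _ => [|y z|g _]; [exact: integral0|exact: integral_add|].
have -> : x@_g *g: g = (x@_g)%:A * (1 *g: g).
  by rewrite mulr_algl gr_scaleU mulr1.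
apply: (@integral_mul _ A); first exact: (@integral_id _ A).
have [n [n_gt0 gn1 _]] := torsionG g.
exists ('X^n - 1); first exact: monicXnsubC.
rewrite rmorphB rmorph1 /= map_polyXn rootE !hornerE.
have -> : (1 *g: g : A) ^+ n = 1 by rewrite gr_expU gn1 expr1n.
by rewrite subrr.
Qed.


(** The contraction [m] of a maximal ideal [M] of [R G] is maximal. Let [r] be
    outside [m], and [x] an inverse of [r] modulo [M]. In a monic equation of
    degree [n] for [x], multiply by [r ^ n] and replace [r * x] by [1]: this puts
    in [m] an element of the form [1 + r * c], so an ideal containing [m] and
    [r] is the whole of [R]. *)
Lemma scalar_jacobson a :
  jacobson_radical R a -> jacobson_radical RG a%:A.
Proof.
move=> Ja M maxM; have [[M0 MD MM] _ _] := maxM.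
pose m := [set r : R | M r%:A].
have idm : left_ideal m.
  split=> [|r s mr ms|r s ms] /=; rewrite /m /=.
  - by rewrite scale0r.
  - by rewrite scalerDl; apply: MD.
  - by rewrite -scalerA -mulr_algl; apply: MM.
apply: (Ja m); split=> // [mT|I idI mI].
  apply: (maximal_left_ideal_proper maxM); rewrite -[1]scale1r.
  by have : m 1 by rewrite mT.
have [Im|Inm] := pselect (I `<=` m); first by left; apply/seteqP.
right; have [r [Ir mnr]] : exists r, I r /\ ~ m r.
  apply: contrapT => nIm; apply: Inm => r Ir.
  by apply: contrapT => mnr; apply: nIm; exists r.
have [x Mx] := maximal_left_ideal_inverse maxM mnr.
have [P monP rootP] := groupRing_integral x.
have [I0 ID IM] := idI.
suff I1 : I 1 by apply/seteqP; split=> // b _; rewrite -[b]mulr1; apply: IM.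
pose n := (size P).-1.
have szP : size P = n.+1 by rewrite /n prednK // size_poly_gt0 monic_neq0.
pose c i := P`_i * r ^+ (n - i).
have Mrx i : M (1 - (r *: x) ^+ i).
  elim: i => [|i IHi]; first by rewrite expr0 subrr.
  have -> : 1 - (r *: x) ^+ i.+1
      = (1 - x * r%:A) + (r *: x) * (1 - (r *: x) ^+ i).
    by rewrite mulrBr mulr1 -exprS grC mulr_algl addrA subrK.
  by apply: MD => //; apply: MM.
have Mc : M (\sum_(i < n.+1) c i)%:A.
  have -> : (\sum_(i < n.+1) c i)%:A
      = \sum_(i < n.+1) (c i)%:A * (1 - (r *: x) ^+ i) :> RG.
    under [RHS]eq_bigr => i _ do rewrite mulr_algl scalerBr.
    rewrite sumrB -scaler_suml.
    suff -> : \sum_(i < n.+1) c i *: (r *: x) ^+ i = 0 by rewrite subr0.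
    transitivity (r ^+ n *: (map_poly (GRing.in_alg RG) P).[x]); last first.
      by rewrite (eqP rootP) scaler0.
    rewrite (@horner_coef_wide _ n.+1); last by rewrite -szP; apply: size_poly.
    rewrite scaler_sumr; apply: eq_bigr => i _.
    rewrite coef_map /= mulr_algl gr_exprZ !scalerA /c; congr (_ *: _).
    by rewrite -mulrA -exprD (subnK (ltn_ord i : (i <= n)%N)) mulrC.
  by apply: left_ideal_sum => // i _; apply: MM.
have := mI _ Mc; rewrite big_ord_recr /= {2}/c subnn expr0 mulr1.
have -> : P`_n = 1 by move/monicP: monP; rewrite lead_coefE.
move=> Ic; rewrite -[1](addKr (\sum_(i < n) c i)) addrC.
apply: left_idealB => //; apply: left_ideal_sum => // i _.
by rewrite /c -subnSK // exprSr mulrA; apply: IM.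
Qed.

(** Over the field [R / m] this says that an algebraic element of the radical is
    nilpotent: write its equation as [x ^ j * (c + x * w) = 0] with [c] nonzero;
    the second factor is a unit as [x] is in the radical. The unit is reached by
    induction on the polynomial, whose lowest coefficient is moved into the
    ideal as long as it lies in [m]. *)
Lemma jacobson_exp_coef_in m x :
  maximal_left_ideal m -> jacobson_radical RG x ->
  exists j, coef_in m (x ^+ j).
Proof.
move=> maxm Jx; have [idm _ _] := maxm; have [m0 mD mM] := idm.
have idc := coef_in_left_ideal idm; have [c0 cD cM] := idc.
have cZ a y : coef_in m y -> coef_in m (a *: y).
  by move=> cy; rewrite -mulr_algl; apply: cM.
have cZl a y : m a -> coef_in m (a *: y).
  by move=> ma g; rewrite mcoeffZ mulrC; apply: mM.
suff main P : forall i,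
    coef_in m (x ^+ i * (map_poly (GRing.in_alg RG) P).[x]) ->
    (exists n, ~ m P`_n) -> exists j, coef_in m (x ^+ j).
  have [P monP rootP] := groupRing_integral x.
  apply: (main P 0%N); first by rewrite (eqP rootP) mulr0.
  exists (size P).-1; rewrite -lead_coefE (monicP monP).
  exact: maximal_left_ideal_proper maxm.
elim/poly_ind: P => [i _ [n]|P c IHP i]; first by rewrite coef0.
rewrite rmorphD rmorphM /= map_polyX map_polyC hornerMXaddC /=.
set w := (_).[x] => cPx [n mnP].
have [mc|mnc] := pselect (m c).
  apply: (IHP i.+1).
    have -> : x ^+ i.+1 * w = x ^+ i * (w * x + c%:A) - c *: x ^+ i.
      by rewrite mulrDr gr_algr addrK exprSr -mulrA (grC x).
    by apply: (left_idealB idc) => //; apply: cZl.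
  exists n.-1; move: mnP; rewrite coefD coefMX coefC.
  by case: n => [|n] /=; rewrite ?add0r ?addr0.
have [d md] := maximal_left_ideal_inverse maxm mnc.
have [b bu1] := jacobson_left_inverse (- (d *: w)) Jx.
exists i; rewrite -[x ^+ i]mul1r -bu1 -mulrA; apply: cM.
have -> : (1 - - (d *: w) * x) * x ^+ i
    = d *: (x ^+ i * (w * x + c%:A)) + (1 - d * c) *: x ^+ i.
  rewrite mulNr opprK mulrDl mul1r scalerBl scale1r mulrDr scalerDr.
  rewrite gr_algr scalerA -addrA [_ *: _ + (_ - _)]addrC subrK addrC.
  by rewrite -!scalerAl (grC _ (x ^+ i)).
by apply: cD; [apply: cZ|apply: cZl].
Qed.

(** Some power of [y] has its coefficients in [m], hence so has a power with
    exponent [p ^ (k * j)], whose coefficients are the powers of those of [y]. *)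
Lemma jacobson_mcoeff_fixed p k y h :
  p \in [pchar R] -> (0 < k)%N ->
  (forall g, g \in msupp y -> (g ^+ (p ^ k))%g = g) ->
  jacobson_radical RG y -> jacobson_radical R y@_h.
Proof.
move=> pR k_gt0 yfix Jy m maxm; have p_pr := pcharf_prime pR.
have [j cyj] := jacobson_exp_coef_in maxm Jy.
apply: (@maximal_left_ideal_exp R (@mulrC R) m _ (p ^ (k * j)) maxm).
rewrite -(mcoeff_exp_fixed pR j h yfix).
have lej : (j <= p ^ (k * j))%N.
  apply: leq_trans (ltnW (ltn_expl j (prime_gt1 p_pr))) _.
  by rewrite leq_exp2l ?prime_gt1 // leq_pmull.
have [idm _ _] := maxm; have [_ _ cM] := coef_in_left_ideal idm.
by rewrite -(subnK lej) exprD; apply: cM.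
Qed.

(** If [n] were invertible, [s / n] below would be a nonzero idempotent of the
    radical. In general put [t = a *: s], so that [t * t = (a * n) *: t], and let
    [v] be the inverse of [1 - t]; then [(1 - a * n) *: (v * t) = t]. At [g] the
    coefficient of [t] is [- a], so [1 - a * n] divides [a], and therefore [1]. *)
Lemma order_jacobson g n :
  has_order g n -> g <> 1%g -> jacobson_radical RG (1 - 1 *g: g) ->
  jacobson_radical R n%:R.
Proof.
move=> og gn1 Jg; have [n_gt0 gn gmin] := og.
have n_gt1 : (1 < n)%N.
  rewrite ltn_neqAle n_gt0 andbT eq_sym; apply/eqP => n1; apply: gn1.
  by rewrite -gn n1.
pose u : RG := 1 *g: g.
have un : u ^+ n = 1 by rewrite gr_expU gn expr1n.
pose nu : RG := \sum_(i < n) u ^+ i.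
have nuu : nu * u = nu.
  have /eqP : (u - 1) * nu = 0 by rewrite -subrX1 un subrr.
  by rewrite grC mulrBr mulr1 subr_eq0 => /eqP.
have nuX i : nu * u ^+ i = nu.
  by elim: i => [|i IHi]; rewrite ?mulr1 // exprSr mulrA IHi.
pose s : RG := \sum_(i < n) (1 - u ^+ i).
have sE : s = n%:R - nu by rewrite /s sumrB sumr_const card_ord.
have ss : s * s = n%:R * s.
  rewrite {2 3}/s !mulr_sumr; apply: eq_bigr => i _.
  by rewrite sE mulrBl [nu * _]mulrBr nuX mulr1 subrr subr0.
have Js : jacobson_radical RG s.
  have [J0 _ JM] := jacobson_left_ideal RG.
  apply: left_ideal_sum; first exact: jacobson_left_ideal.
  move=> i _; have -> : 1 - u ^+ i = (\sum_(j < i) u ^+ j) * (1 - u).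
    by rewrite grC -opprB subrX1 -mulNr opprB.
  exact: JM.
have sg : s@_g = -1.
  rewrite /s gr_mcoeff_sum (bigD1 (Ordinal n_gt1)) //= big1 ?addr0.
    rewrite mcoeffB expr1 !mcoeffU eqxx.
    by case: (1%g =P g) => [g1|_]; [case: gn1|rewrite sub0r].
  move=> i /eqP in1; rewrite mcoeffB gr_expU !mcoeffU expr1n.
  case: (1%g =P g) => [g1|_]; first by case: gn1.
  case: (_ =P g) => [gi|_]; last by rewrite subr0.
  case: in1; apply: val_inj => /=; case: i gi => [[|i] /= lti] gi.
    by case: gn1.
  have gi1 : (g ^+ i = 1)%g by apply: (mulgI g); rewrite -expgS gi mulg1.
  case: i gi1 lti {gi} => // i gi1 lti.
  by have := gmin i.+1 isT gi1; rewrite leqNgt (ltnW lti).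
apply: left_inverse_jacobson => a.
have [v vs1] := jacobson_left_inverse a%:A Js.
pose t := a *: s.
have tt : t * t = (a * n%:R) *: t.
  rewrite /t -scalerAl -gr_scaleAr ss mulr_natl -(scaler_nat n s) !scalerA.
  by rewrite mulrA mulrAC.
have vt : (1 - a * n%:R) *: (v * t) = t.
  have v1 : v * (1 - t) = 1 by move: vs1; rewrite mulr_algl.
  by rewrite scalerBl scale1r gr_scaleAr -tt mulrA -mulrBl -{1}[v]mulr1 -mulrBr v1 mul1r.
(* If [w] is the coefficient of [v * t] at [g], then [(1 - a * n) * w = - a],
   so that [1 = (1 - a * n) + a * n] is [(1 - a * n) * (1 - w * n)]. *)
exists (1 - (v * t)@_g * n%:R).
have := congr1 (mcoeff g) vt; rewrite !mcoeffZ sg mulrN1.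
move=> E; rewrite mulrBl mul1r mulrAC [_@_g * _]mulrC E mulNr opprK.
by rewrite subrK.
Qed.

(** * Determination of the radical *)

Lemma jacobson_groupRing_pchar p :
  p \in [pchar R] -> jacobson_radical R = [set 0] ->
  jacobson_radical RG = Phi R (p_component G p).
Proof.
move=> pR JR0; have p_pr := pcharf_prime pR.
have PhiJ : Phi R (p_component G p) `<=` jacobson_radical RG.
  by apply: Phi_jacobson => g; apply: p_element_jacobson.
apply/seteqP; split=> // x Jx.
have [n n_gt0 xn1] := torsion_exponent torsionG (msupp x).
have [k k_gt0 dvd_n] := p_prime_projection_exponent p_pr n_gt0.
set q := (p ^ k)%N in dvd_n.
have q_gt0 : (0 < q)%N by rewrite expn_gt0 prime_gt0.
have xq1 g : g \in msupp x -> (g ^+ (q * q.-1) = 1)%g.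
  by move=> /xn1 gn1; case/dvdnP: dvd_n => c ->; rewrite mulnC expgnA gn1 expg1n.
pose y : RG := \sum_(g <- msupp x) x@_g *g: (g ^+ q)%g.
have Phixy : Phi R (p_component G p) (x - y).
  exists [seq (1 - 1 *g: (g ^+ q.-1)%g, x@_g *g: g) | g <- msupp x].
    move=> _ /mapP[g xg ->] /=; apply: augmentation_ideal_sub1.
      exact: subgroup_p_component.
    by apply/(p_componentP torsionG _ p_pr); exists k; rewrite -expgnA mulnC xq1.
  rewrite big_map /= {1}(grE x) -sumrB; apply: eq_bigr => g _.
  by rewrite mulrBl mul1r gr_mulU mul1r -expgSr prednK.
have Jy : jacobson_radical RG y.
  rewrite -[y](subKr x).
  exact: left_idealB (@jacobson_left_ideal RG) Jx (PhiJ _ Phixy).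
have yfix h : h \in msupp y -> (h ^+ q = h)%g.
  move=> yh; have [g xg <-] : exists2 g, g \in msupp x & (g ^+ q = h)%g.
    apply: contrapT => nimg; move: yh; rewrite -mcoeff_neq0 gr_mcoeff_sum.
    rewrite big1_seq ?eqxx // => g /andP[_ xg]; rewrite mcoeffU.
    by case: (_ =P h) => // gh; case: nimg; exists g.
  by rewrite -expgnA -{2}(prednK q_gt0) mulnS expgnDr xq1 // mulg1.
have y0 : y = 0.
  apply/malgP => h; rewrite mcoeff0.
  have := jacobson_mcoeff_fixed h pR k_gt0 yfix Jy.
  by rewrite JR0.
by rewrite -[x]subr0 -y0.
Qed.

(** A scalar is its own augmentation, and elements of [Phi N] have none. *)
Lemma Phi_jacobson_scalar_radical N :
  jacobson_radical RG = Phi R N -> jacobson_radical R = [set 0].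
Proof.
move=> JN; apply/seteqP; split=> [a Ja|_ -> M [[M0 _ _] _ _] //].
have := scalar_jacobson Ja; rewrite JN => /Phi_augmentation.
by rewrite gr_algE augmentationU.
Qed.

End Torsion.
End GroupRings.

Theorem proposition2p3 (R : comNzRingType) (G : groupType)
    (mulgC : forall g h : G, commute g h) (torsionG : torsion_group G) :
  ((exists N : set G,
      [/\ subgroup N, N <> [set 1%g]
        & jacobson_radical (groupRing R G) = Phi R N])
   <->
   (jacobson_radical R = [set 0] /\
    exists p : nat, supp_group G p /\ p \in [pchar R]))
  /\
  (forall p : nat,
     jacobson_radical R = [set 0] -> supp_group G p -> p \in [pchar R] ->
     jacobson_radical (groupRing R G) = Phi R (p_component G p)).
Proof.
split; last by move=> p JR0 _ pR; apply: jacobson_groupRing_pchar.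
split=> [[N [subN Nn1 JN]]|[JR0 [p [[p_pr Gpn1] pR]]]]; last first.
  exists (p_component G p); split=> //; first exact: subgroup_p_component.
  exact: jacobson_groupRing_pchar.
have JR0 := Phi_jacobson_scalar_radical mulgC torsionG JN.
split=> //; have [N1 NM _] := subN.
have [g [Ng gn1]] : exists g, N g /\ g <> 1%g.
  apply: contrapT => nog; apply: Nn1; apply/seteqP; split=> [g Ng|_ ->] //=.
  by apply: contrapT => gn1; apply: nog; exists g.
have [n og] := torsionG g; have [n_gt0 gn _] := og.
have n_gt1 : (1 < n)%N.
  rewrite ltn_neqAle n_gt0 andbT eq_sym; apply/eqP => n1; apply: gn1.
  by rewrite -gn n1.
pose p := pdiv n; have p_pr : prime p := pdiv_prime n_gt1.
have oh := has_order_expg og (pdiv_dvd n); set h := (g ^+ _)%g in oh.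
have Nh : N h.
  by rewrite /h; elim: (n %/ _)%N => [|m IHm] //; rewrite expgS; apply: NM.
have hn1 : h <> 1%g.
  move=> h1; case: oh => _ _ /(_ 1%N isT); rewrite h1 => /(_ (expg1n _ _)).
  by rewrite leqNgt prime_gt1.
exists p; split.
  split=> // Gp1; apply: hn1.
  have : p_component G p h by exists 1%N; rewrite expn1.
  by rewrite Gp1.
have := Phi_sub1 R subN Nh; rewrite -JN => Jh.
have := order_jacobson mulgC oh hn1 Jh; rewrite JR0 => /= p0.
by rewrite inE p_pr p0 eqxx.
Qed.
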